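(* Let $(X_{\alpha},\delta_{\alpha})_{\alpha\in I}$ be an infinite collection (that is, $I$ is infinite) of nonempty separated proximity spaces, let $(\coprod_{\alpha}X_{\alpha},\delta)$ be its coproduct, and let $(\overline{\coprod_{\alpha}X_{\alpha}},\delta^{*})$ be the Smirnov compactification of this coproduct. Then $(\overline{\coprod_{\alpha}X_{\alpha}})\setminus(\coprod_{\alpha}X_{\alpha})$ contains a copy of (a subspace homeomorphic to) $\beta\omega\setminus\omega$. In particular, the topology on $\overline{\coprod_{\alpha}X_{\alpha}}$ is not metrizable. Consequently, the proximity $\delta^{*}$ on $\overline{\coprod_{\alpha}X_{\alpha}}$ is not a metric proximity for any metric.
   Context: $\omega$ is a countably infinite discrete space and $\beta\omega$ its Stone-Čech compactification. A proximity on a set $X$ is a binary relation $\delta$ on the power set of $X$ such that for all $A,B,C\subseteq X$: (1) $A\delta B\Rightarrow B\delta A$; (2) $A\delta B\Rightarrow A,B\neq\emptyset$; (3) $A\cap B\neq\emptyset\Rightarrow A\delta B$; (4) $A\delta(B\cup C)\iff A\delta B$ or $A\delta C$; (5) if not $A\delta B$, then there is $E\subseteq X$ with not $A\delta E$ and not $(X\setminus E)\delta B$. It is separated if $\{x\}\delta\{y\}\iff x=y$. It induces a topology on $X$: $A$ is closed iff ($\{x\}\delta A$ implies $x\in A$). The metric proximity of a metric $d$ on $X$ is given by: $A\delta B$ iff $A,B\ne\emptyset$ and $\inf\{d(a,b): a\in A,b\in B\}=0$. The coproduct of proximity spaces $(X_\alpha,\delta_\alpha)_{\alpha\in I}$ is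 the disjoint union $\coprod_\alpha X_\alpha$ with $A\delta B\iff A_\alpha\delta_\alpha B_\alpha$ for some $\alpha$, where $A_\alpha:=A\cap X_\alpha$. A cluster in a separated proximity space $(X,\delta)$ is a nonempty collection $\sigma$ of subsets of $X$ such that: (1) $A\delta B$ for all $A,B\in\sigma$; (2) if $C\delta A$ for all $A\in\sigma$ then $C\in\sigma$; (3) if $A\cup B\in\sigma$ then $A\in\sigma$ or $B\in\sigma$. Let $\mathfrak{X}$ be the set of all clusters; $C\subseteq X$ absorbs $\mathcal{A}\subseteq\mathfrak{X}$ if $C\in\sigma$ for every $\sigma\in\mathcal{A}$. Define $\mathcal{A}\delta^{*}\mathcal{B}$ iff $A\delta B$ for all $A,B\subseteq X$ absorbing $\mathcal{A},\mathcal{B}$ respectively. Then $(\mathfrak{X},\delta^{*})$ is a separated proximity space with compact Hausdorff induced topology, the Smirnov compactification of $(X,\delta)$; $X$ is regarded as a dense subspace of it via $x\mapsto\{A\subseteq X:\{x\}\delta A\}$. *)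

(* Defs.v *)
From HB Require Import structures.
From mathcomp Require Import all_boot all_order all_algebra.
From mathcomp Require Import all_classical all_reals.
From mathcomp Require Import topology.

Set Implicit Arguments.
Unset Strict Implicit.
Unset Printing Implicit Defensive.

Import Order.TTheory GRing.Theory Num.Theory.
Local Open Scope classical_set_scope.
Local Open Scope ring_scope.

HB.mixin Record isProximity (X : Type) := {
  prox : set X -> set X -> Prop ;
  prox_sym : forall A B, prox A B -> prox B A ;
  prox_nonempty : forall A B, prox A B -> A !=set0 /\ B !=set0 ;
  prox_meets : forall A B, A `&` B !=set0 -> prox A B ;
  prox_setU : forall A B C, prox A (B `|` C) <-> prox A B \/ prox A C ;
  prox_split : forall A B, ~ prox A B ->
    exists E, ~ prox A E /\ ~ prox (~` E) B
}.

#[short(type="proximityType")]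
HB.structure Definition Proximity := {X of isProximity X}.

HB.mixin Record Proximity_isSeparated X & Proximity X := {
  prox_set1 : forall x y : X, prox [set x] [set y] <-> x = y
}.

#[short(type="sepProximityType")]
HB.structure Definition SepProximity :=
  {X of Proximity X & Proximity_isSeparated X}.

Arguments prox_sym {s} [A B].
Arguments prox_nonempty {s} [A B].
Arguments prox_meets {s} [A B].
Arguments prox_setU {s A B C}.
Arguments prox_split {s} [A B].
Arguments prox_set1 {s x y}.

Section proximity_lemmas.
Context {X : proximityType}.
Implicit Types A B C : set X.

Lemma proxS A B C : B `<=` C -> prox A B -> prox A C.
Proof. by move=> /setUidPr <- AB; apply/prox_setU; left. Qed.

Lemma proxSS A A' B B' : A `<=` A' -> B `<=` B' -> prox A B -> prox A' B'.
Proof.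
by move=> AA' BB' /(proxS BB') /prox_sym /(proxS AA') /prox_sym.
Qed.

Lemma prox_set1P A x : A x -> prox [set x] A.
Proof. by move=> Ax; apply: prox_meets; exists x. Qed.

Lemma prox_point A B x : prox [set x] A -> prox [set x] B -> prox A B.
Proof.
move=> xA xB; apply: contrapT => /prox_split[E [AE EB]].
have [Ex|nEx] := pselect (E x).
  by apply: AE; apply/prox_sym; apply: proxSS xA => // _ ->.
by apply: EB; apply: proxSS xB => // _ ->.
Qed.

End proximity_lemmas.

(* The topology lives on an alias, so that a proximity space is a bare type
   with a proximity: no choice structure or topology is part of the data. *)

Definition prox_topology (X : Type) : Type := X.

HB.instance Definition _ (X : Type) := gen_eqMixin (prox_topology X).
HB.instance Definition _ (X : Type) := gen_choiceMixin (prox_topology X).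

Section prox_topology.
Context {X : proximityType}.

Definition prox_closed (A : set X) := forall x, prox [set x] A -> A x.

Let prox_open : set_system (prox_topology X) :=
  [set A | prox_closed (~` A)].

Let prox_openT : prox_open setT.
Proof. by rewrite /prox_open/= setCT => x /prox_nonempty[_ []]. Qed.

Let prox_openI : setI_closed prox_open.
Proof.
move=> A B oA oB x; rewrite setCI => /prox_setU[/oA|/oB]; first by left.
by right.
Qed.

Let prox_open_bigU (I : Type) (f : I -> set (prox_topology X)) :
  (forall i, prox_open (f i)) -> prox_open (\bigcup_i f i).
Proof.
move=> of_ x; rewrite setC_bigcup => xf i _; apply: of_; apply: proxS xf.
by apply: bigcap_inf.
Qed.

HB.instance Definition _ := isOpenTopological.Build (prox_topology X)
  prox_openT prox_openI prox_open_bigU.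

Lemma prox_topology_closedE (A : set (prox_topology X)) :
  closed A <-> prox_closed A.
Proof.
by rewrite -openC; split; rewrite /open/= /prox_open/= setCK.
Qed.

End prox_topology.

Definition prox_coprod (I : Type) (X : I -> Type) : Type := {i : I & X i}.

Definition coprod_slice (I : Type) (X : I -> Type) (A : set (prox_coprod X))
  (i : I) : set (X i) := existT X i @^-1` A.
Arguments coprod_slice {I X} A i.

Section coproduct.
Context {I : Type} {X : I -> proximityType}.

Definition coprod_prox (A B : set (prox_coprod X)) :=
  exists i, prox (coprod_slice A i) (coprod_slice B i).

Let coprod_prox_sym A B : coprod_prox A B -> coprod_prox B A.
Proof. by move=> [i /prox_sym AB]; exists i. Qed.

Let coprod_prox_nonempty A B : coprod_prox A B -> A !=set0 /\ B !=set0.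
Proof.
by move=> [i /prox_nonempty[[x Ax] [y By]]]; split;
  [exists (existT X i x)|exists (existT X i y)].
Qed.

Let coprod_prox_meets A B : A `&` B !=set0 -> coprod_prox A B.
Proof. by move=> [[i x] [Ax Bx]]; exists i; apply: prox_meets; exists x. Qed.

Let coprod_prox_setU A B C :
  coprod_prox A (B `|` C) <-> coprod_prox A B \/ coprod_prox A C.
Proof.
split=> [[i /prox_setU[]]|[[i]|[i]] AB]; first by left; exists i.
- by right; exists i.
- by exists i; apply/prox_setU; left.
- by exists i; apply/prox_setU; right.
Qed.

Let coprod_prox_split A B : ~ coprod_prox A B ->
  exists E, ~ coprod_prox A E /\ ~ coprod_prox (~` E) B.
Proof.
move=> AB; have H i : exists E : set (X i),
    ~ prox (coprod_slice A i) E /\ ~ prox (~` E) (coprod_slice B i).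
  by apply: prox_split => ABi; apply: AB; exists i.
pose E i := projT1 (cid (H i)).
have EP i : ~ prox (coprod_slice A i) (E i) /\
    ~ prox (~` E i) (coprod_slice B i) by exact: projT2 (cid (H i)).
exists [set u | E (projT1 u) (projT2 u)].
by split=> -[i]; have [? ?] := EP i.
Qed.

HB.instance Definition _ := isProximity.Build (prox_coprod X)
  coprod_prox_sym coprod_prox_nonempty coprod_prox_meets coprod_prox_setU
  coprod_prox_split.

End coproduct.

Section separated_coproduct.
Context {I : Type} {X : I -> sepProximityType}.

Let coprod_prox_set1 (u v : prox_coprod X) : prox [set u] [set v] <-> u = v.
Proof.
split=> [[i ij]|->]; last by apply: prox_meets; exists v.
have [[x xu] [y yv]] := prox_nonempty ij; rewrite -xu -yv; congr existT.
apply/prox_set1; apply: proxSS ij => z /= zE;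
  by apply: (@existT_inj2 {classic I} X i); rewrite [LHS]zE.
Qed.

HB.instance Definition _ :=
  Proximity_isSeparated.Build (prox_coprod X) coprod_prox_set1.

End separated_coproduct.

Record is_cluster (X : sepProximityType) (s : set (set X)) : Prop := {
  cluster_nonempty : s !=set0 ;
  cluster_prox : forall A B, s A -> s B -> prox A B ;
  cluster_maximal : forall C, (forall A, s A -> prox C A) -> s C ;
  cluster_setU : forall A B, s (A `|` B) -> s A \/ s B
}.

Definition smirnov (X : sepProximityType) : Type :=
  {s : set (set X) | is_cluster s}.

Definition absorbs (X : sepProximityType) (C : set X) (A : set (smirnov X)) :=
  forall s, A s -> sval s C.

Definition smirnov_prox (X : sepProximityType) (A B : set (smirnov X)) :=
  forall C D : set X, absorbs C A -> absorbs D B -> prox C D.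

Section smirnov.
Context {X : sepProximityType}.
Implicit Types (s : smirnov X) (A B C : set (smirnov X)) (U V : set X).

Lemma smirnovS s U V : U `<=` V -> sval s U -> sval s V.
Proof.
case: s => s cs /= UV sU; apply: (cluster_maximal cs) => W sW.
by apply: proxSS (cluster_prox cs sU sW).
Qed.

Lemma smirnov_setT s : sval s setT.
Proof.
by have [U sU] := cluster_nonempty (svalP s); exact: smirnovS sU.
Qed.

Lemma smirnov_setC s U : ~ sval s U -> sval s (~` U).
Proof.
by have := smirnov_setT s; rewrite -(setUv U) => /(cluster_setU (svalP s))[].
Qed.

Lemma smirnov_inj s t : (forall U V, sval s U -> sval t V -> prox U V) -> s = t.
Proof.
move=> st; apply: eq_sig_hprop => [?|]; first exact: Prop_irrelevance.
case: s t st => s cs [t ct] /= st; apply/seteqP; split=> U.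
- by move=> sU; apply: (cluster_maximal ct) => V tV; exact: st.
- move=> tU; apply: (cluster_maximal cs) => V sV.
  by apply: prox_sym; exact: st.
Qed.

Let smirnov_prox_sym A B : smirnov_prox A B -> smirnov_prox B A.
Proof. by move=> AB U V UA VB; apply/prox_sym/AB. Qed.

Let smirnov_prox_nonempty A B :
  smirnov_prox A B -> A !=set0 /\ B !=set0.
Proof.
move=> AB; split; apply/set0P/eqP => E0.
- have : prox (set0 : set X) setT.
    by apply: AB => s; rewrite ?E0// => _; exact: smirnov_setT.
  by move=> /prox_nonempty[[]].
- have : prox setT (set0 : set X).
    by apply: AB => s; rewrite ?E0// => _; exact: smirnov_setT.
  by move=> /prox_nonempty[_ []].
Qed.

Let smirnov_prox_meets A B : A `&` B !=set0 -> smirnov_prox A B.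
Proof.
move=> [s [As Bs]] U V UA VB.
by apply: (cluster_prox (svalP s)); [exact: UA|exact: VB].
Qed.

Let smirnov_proxS A B C : B `<=` C -> smirnov_prox A B -> smirnov_prox A C.
Proof. by move=> BC AB U V UA VC; apply: AB => // s /BC; exact: VC. Qed.

Let smirnov_farP A B : ~ smirnov_prox A B ->
  exists U V, [/\ absorbs U A, absorbs V B & ~ prox U V].
Proof.
move=> AB; apply: contrapT => nUV; apply: AB => U V UA VB.
by apply: contrapT => UV; apply: nUV; exists U, V.
Qed.

Let smirnov_prox_setU A B C :
  smirnov_prox A (B `|` C) <-> smirnov_prox A B \/ smirnov_prox A C.
Proof.
split; last first.
  by move=> [|]; apply: smirnov_proxS => s ?; [left|right].
move=> ABC; apply: contrapT => /not_orP[].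
move=> /smirnov_farP[U1 [V1 [U1A V1B UV1]]].
move=> /smirnov_farP[U2 [V2 [U2A V2C UV2]]].
have [E1 [UE1 EV1]] := prox_split UV1.
have [E2 [UE2 EV2]] := prox_split UV2.
have : prox (~` (E1 `|` E2)) (V1 `|` V2).
  apply: ABC => s; last first.
    by move=> [/V1B|/V2C]; apply: smirnovS => x ?; [left|right].
  move=> As; apply: smirnov_setC => /(cluster_setU (svalP s))[sE|sE].
  - by apply: UE1; apply: (cluster_prox (svalP s)) => //; exact: U1A.
  - by apply: UE2; apply: (cluster_prox (svalP s)) => //; exact: U2A.
move=> /prox_setU[] EV; [apply: EV1|apply: EV2]; apply: proxSS EV => // x.
- by move=> /not_orP[].
- by move=> /not_orP[].
Qed.

Let smirnov_prox_split A B : ~ smirnov_prox A B ->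
  exists E, ~ smirnov_prox A E /\ ~ smirnov_prox (~` E) B.
Proof.
move=> /smirnov_farP[U [V [UA VB UV]]]; have [E [UE EV]] := prox_split UV.
exists [set s | sval s E]; split=> [AE|EB].
  by apply: UE; apply: AE => // s.
by apply: EV; apply: EB => // s; exact: smirnov_setC.
Qed.

HB.instance Definition _ := isProximity.Build (smirnov X)
  smirnov_prox_sym smirnov_prox_nonempty smirnov_prox_meets
  smirnov_prox_setU smirnov_prox_split.

Let smirnov_prox_set1 s t : prox [set s] [set t] <-> s = t.
Proof.
split=> [st|->]; last by apply: prox_meets; exists t.
by apply: smirnov_inj => U V sU tV; apply: st => _ ->.
Qed.

HB.instance Definition _ :=
  Proximity_isSeparated.Build (smirnov X) smirnov_prox_set1.

HB.instance Definition _ :=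
  Topological.copy (smirnov X) (prox_topology (smirnov X)).

Lemma point_cluster (x : X) : is_cluster [set A : set X | prox [set x] A].
Proof.
split=> /= [|A B|C Cx|A B /prox_setU//]; first by exists [set x]; exact/prox_set1.
- exact: prox_point.
- by apply/prox_sym; apply: Cx; exact/prox_set1.
Qed.

Definition smirnov_point (x : X) : smirnov X := exist _ _ (point_cluster x).

End smirnov.

Record is_metric (R : realType) (T : Type) (d : T -> T -> R) : Prop := {
  is_metric_xx : forall x, d x x = 0 ;
  is_metric_eq : forall x y, d x y = 0 -> x = y ;
  is_metric_sym : forall x y, d x y = d y x ;
  is_metric_triangle : forall y x z, d x z <= d x y + d y z
}.

Definition metrizable (R : realType) (T : topologicalType) :=
  exists2 d : T -> T -> R, is_metric d &
    forall U : set T, open U <->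
      forall x, U x -> exists2 e, 0 < e & [set y | d x y < e] `<=` U.

Definition metric_prox (R : realType) (T : Type) (d : T -> T -> R)
    (A B : set T) :=
  [/\ A !=set0, B !=set0 & inf [set d a b | a in A & b in B] = 0].

Definition homeomorphic (S T : topologicalType) :=
  exists (f : S -> T) (g : T -> S),
    [/\ continuous f, continuous g, cancel f g & cancel g f].

(* The points of the Stone-Cech compactification of the discrete space [nat]
   are the ultrafilters on [nat]; the sets of all ultrafilters containing a
   given [A] are a base of its topology. *)
Definition betaomega : Type := {F : set_system nat | UltraFilter F}.

HB.instance Definition _ := gen_eqMixin betaomega.
HB.instance Definition _ := gen_choiceMixin betaomega.

Definition betaomega_base (A : set nat) : set betaomega := [set F | sval F A].

Lemma betaomega_cover : \bigcup_(A in setT) betaomega_base A = setT.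
Proof.
apply/seteqP; split=> // -[F UF] _; exists setT => //; exact: filterT.
Qed.

Lemma betaomega_join (A B : set nat) (F : betaomega) : setT A -> setT B ->
  betaomega_base A F -> betaomega_base B F ->
  exists C, [/\ setT C, betaomega_base C F &
    betaomega_base C `<=` betaomega_base A `&` betaomega_base B].
Proof.
move=> _ _ FA FB; exists (A `&` B); split=> //.
  by case: F FA FB => F UF; exact: filterI.
by move=> [G UG] GAB; split; apply: filterS GAB => x [].
Qed.

HB.instance Definition _ := isBaseTopological.Build betaomega
  betaomega_cover betaomega_join.

Definition betaomega_point (n : nat) : betaomega :=
  exist _ (principal_filter n) (principal_filter_ultra n).

(* [betaomega], with the embedding [betaomega_point], is indeed the Stone-Cech
   compactification of [nat]. *)

Lemma ultra_setVsetC (T : Type) (F : set_system T) :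
  ProperFilter F -> (forall A, F A \/ F (~` A)) -> UltraFilter F.
Proof.
move=> PF FC; split=> // G PG FG; apply/seteqP; split=> // A GA.
have [//|/FG GnA] := FC A.
by have [x []] := filter_ex (filterI GA GnA).
Qed.

Lemma betaomega_base_open (A : set nat) : open (betaomega_base A).
Proof. by exists [set A] => //; rewrite bigcup_set1. Qed.

Lemma betaomega_nbhsP (F : betaomega) (U : set betaomega) :
  nbhs F U <-> exists2 A, sval F A & betaomega_base A `<=` U.
Proof.
split=> [|[A FA AU]]; last first.
  by apply: filterS AU _; apply: open_nbhs_nbhs; split;
    [exact: betaomega_base_open|].
rewrite nbhsE => -[V [[D _ <-] [A DA FA]] VU]; exists A => //.
by move=> G GA; apply: VU; exists A.
Qed.

Lemma betaomega_compact : compact [set: betaomega].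
Proof.
rewrite compact_ultra => G UG _; pose F := [set A | G (betaomega_base A)].
have baseC A : ~` betaomega_base A `<=` betaomega_base (~` A).
  by move=> [H UH] /= nHA; have [] := in_ultra_setVsetC A UH.
have FF : Filter F.
  split.
  - by apply: (@filterS _ G) filterT => -[H UH] _; exact: filterT.
  - move=> A B FA FB; apply: (@filterS _ G) (@filterI _ G _ _ _ FA FB).
    by move=> [H UH] []; exact: filterI.
  - by move=> A B AB; apply: (@filterS _ G) => -[H UH]; exact: filterS.
have PF : ProperFilter F.
  apply: (Build_ProperFilter_ex _ FF) => A FA.
  have [[H UH] HA] := @filter_ex _ G _ _ FA.
  exact: filter_ex HA.
have UF : UltraFilter F.
  apply: ultra_setVsetC => A.
  have [|/(filterS (@baseC A))] := in_ultra_setVsetC (betaomega_base A) UG.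
    by left.
  by right.
exists (exist _ F UF); split=> // U /betaomega_nbhsP[A FA].
by move=> AU; apply: filterS AU FA.
Qed.

Lemma betaomega_hausdorff : hausdorff_space betaomega.
Proof.
move=> F G FG; apply: eq_sig_hprop => [?|]; first exact: Prop_irrelevance.
have FsubG (F' G' : betaomega) : cluster (nbhs F') G' -> sval F' `<=` sval G'.
  move=> FG' A F'A; have [//|G'A] := in_ultra_setVsetC A (svalP G').
  have [] := FG' (betaomega_base A) (betaomega_base (~` A)).
  - by apply/betaomega_nbhsP; exists A.
  - by apply/betaomega_nbhsP; exists (~` A).
  - by move=> [H UH] [HA] /(filterI HA)/(@filter_ex _ H _)[x []].
have FF := svalP F; have GG := svalP G.
symmetry; apply: max_filter; exact: FsubG.
Qed.

Lemma betaomega_dense : dense (range betaomega_point).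
Proof.
move=> U [F UF] oU; have /betaomega_nbhsP[A FA AU] : nbhs F U.
  exact: open_nbhs_nbhs.
have [n An] := @filter_ex _ (sval F) (@ultra_proper _ _ (svalP F)) _ FA.
by exists (betaomega_point n); split; [apply/AU/principal_filterP|exists n].
Qed.

Lemma betaomega_point_inj : injective betaomega_point.
Proof.
move=> m n mn; have : sval (betaomega_point m) [set m].
  exact/principal_filterP.
by rewrite mn => /principal_filterP ->.
Qed.

Lemma betaomega_point_open (n : nat) : open [set betaomega_point n].
Proof.
suff -> : [set betaomega_point n] = betaomega_base [set n].
  exact: betaomega_base_open.
apply/seteqP; split=> [_ ->|[F UF] /= Fn]; first exact/principal_filterP.
apply: eq_sig_hprop => [?|]; first exact: Prop_irrelevance.
have Un := principal_filter_ultra n.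
by apply: max_filter => A /principal_filterP An; apply: filterS Fn => _ ->.
Qed.

Lemma betaomega_extend (K : topologicalType) (f : nat -> K) :
  hausdorff_space K -> compact [set: K] ->
  exists2 g : betaomega -> K,
    continuous g & forall n, g (betaomega_point n) = f n.
Proof.
move=> hK cK.
have Uf (F : betaomega) : UltraFilter (f @ sval F).
  case: F => F UF; apply: ultra_setVsetC => A.
  by have [] := in_ultra_setVsetC (f @^-1` A) UF; [left|right].
have H (F : betaomega) : exists p : K, f @ sval F --> p.
  move: cK; rewrite compact_ultra => /(_ _ (Uf F) filterT)[p [_ ?]].
  by exists p.
have [g gP] := choice H; exists g => [F U|n].
  have Kreg : {for g F, @regular_space K}.
    by apply: compact_regular cK _; [exact: hK|exact: filterT].
  move=> /Kreg[V Vg VU]; apply/betaomega_nbhsP; exists (f @^-1` V).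
    exact: gP.
  move=> G GV; apply: VU => W /gP GW.
  have PG := @ultra_proper _ _ (Uf G).
  exact: filter_ex (filterI (GV : (f @ sval G) V) GW).
have Un := @ultra_proper _ _ (Uf (betaomega_point n)).
apply: (cvg_unique hK (gP (betaomega_point n))).
by move=> U /nbhs_singleton Ufn; apply/principal_filterP.
Qed.

(* Main.v *)
Require Import Defs.
From mathcomp Require Import all_boot all_order all_algebra.
From mathcomp Require Import all_classical all_reals.
From mathcomp Require Import topology.
Local Open Scope classical_set_scope.

(** Choosing one point in each of countably many summands of the coproduct
    gives a sequence [u] of distinct points whose proximity to any set is
    decided pointwise: [C] is near [u @` A] only if it is near a single [u n]
    with [n] in [A].  For such a sequence, every ultrafilter [F] on [nat]
    defines a cluster, namely the sets [C] for which the set of [n] with [C]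
    near [u n] belongs to [F]: it is maximal because, when that set is not in
    [F], its complement [A] is, and [u @` A] is a member of the cluster that is
    far from [C].  The resulting map from the space of ultrafilters to the
    Smirnov compactification is injective, continuous and open onto its image
    ([beta_embed_inj], [beta_embed_continuous], [beta_embed_open]), since the
    trace on the sequence of the cluster of [F] is [F] itself.  If the cluster
    of [F] is a point [p], then the set of [n] with [u n = p] is in [F], so [F]
    is principal; hence the free ultrafilters are sent to the remainder, which
    gives the first claim.

    In a metrizable topology every point has a countable base of
    neighbourhoods.  Pulled back to the ultrafilters, this would make some free
    ultrafilter countably generated, and that fails because for countably many
    infinite sets there is a set that splits them all
    ([free_ultrafilter_not_countably_generated]).  Finally, a metric
    inducing the proximity also induces the topology of the proximity, so the
    last claim reduces to the second. *)

(** * Ultrafilters on the natural numbers *)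

Lemma betaomega_ext (F G : betaomega) : sval F `<=` sval G -> F = G.
Proof.
move=> FG; apply: eq_sig_hprop => [?|]; first exact: Prop_irrelevance.
have UG := svalP G; have UF := svalP F.
by symmetry; apply: max_filter.
Qed.

Lemma betaomega_set1 (F : betaomega) n :
  sval F [set n] -> F = betaomega_point n.
Proof.
have UF := svalP F; have Un := principal_filter_ultra n.
move=> Fn; symmetry; apply: betaomega_ext => A /principal_filterP An.
by apply: filterS Fn => _ ->.
Qed.

Lemma free_ultrafilter_exists : exists F : betaomega, \oo `<=` sval F.
Proof.
have [F [UF ooF]] := ultraFilterLemma eventually_filter.
by exists (exist _ F UF).
Qed.

(** The sequence [c] meets each [B k] at both the index [2 k] and the index
    [2 k + 1], and is increasing so that these values are all distinct; its
    even-indexed values then form a splitting set. *)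
Lemma split_infinite_sets (B : nat -> set nat) :
  (forall k m, exists2 n, (m < n)%N & B k n) ->
  exists E : set nat, forall k, ~ B k `<=` E /\ ~ B k `<=` ~` E.
Proof.
move=> Binf.
have /choice[h hP] : forall km : nat * nat,
    exists n, (km.2 < n)%N /\ B km.1 n.
  by move=> [k m]; have [n ? ?] := Binf k m; exists n.
pose c := fix c m := if m is m'.+1 then h (m./2, c m') else h (0, 0)%N.
have cB m : B m./2 (c m) by case: m => [|m]; exact: (hP (_, _)).2.
have c_lt : {homo c : m n / (m < n)%N}.
  by apply: homo_ltn => [n m p|m]; [exact: ltn_trans|exact: (hP (_, _)).1].
have c_inj : injective c.
  by move=> m n; case: (ltngtP m n) => // /c_lt + cmn; rewrite cmn ltnn.
exists [set c k.*2 | k in setT] => k; split=> BE.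
  have /BE[j _ /c_inj] : B k (c k.*2.+1).
    by rewrite -[X in B X]uphalf_double; exact: (cB k.*2.+1).
  by move=> /(congr1 odd); rewrite /= !odd_double.
have /BE : B k (c k.*2) by have := cB k.*2; rewrite doubleK.
by apply; exists k.
Qed.

Lemma free_ultrafilter_not_countably_generated (F : betaomega)
    (B : nat -> set nat) :
  \oo `<=` sval F -> (forall k, sval F (B k)) ->
  ~ forall A, sval F A -> exists k, B k `<=` A.
Proof.
move=> ooF FB Bgen; have UF := svalP F.
have [k m|E EP] := split_infinite_sets B.
  have Fm : sval F [set n | (m < n)%N] by apply: ooF; exists m.+1.
  have PF := @ultra_proper _ _ UF.
  by have [n [? ?]] := filter_ex (filterI Fm (FB k)); exists n.
have [/Bgen|/Bgen] := in_ultra_setVsetC E UF; move=> [k].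
- exact: (EP k).1.
- exact: (EP k).2.
Qed.

(** * Clusters carried by a sequence *)

(** Proximity always distributes over finite unions; along such a sequence it
    distributes over arbitrary unions of points, as it does over the summands
    of a coproduct. *)
Definition pointwise_near {X : proximityType} (u : nat -> X) :=
  forall C A, prox C (u @` A) -> exists2 n, A n & prox C [set u n].

Definition near_indices {X : proximityType} (u : nat -> X) (C : set X) :
  set nat := [set n | prox C [set u n]].

Lemma near_indices_sub {X : proximityType} (u : nat -> X) A :
  A `<=` near_indices u (u @` A).
Proof.
by move=> n An; apply: prox_meets; exists (u n); split=> //; exists n.
Qed.

Lemma near_indices_image {X : sepProximityType} (u : nat -> X) A :
  injective u -> pointwise_near u -> near_indices u (u @` A) = A.
Proof.
move=> u_inj u_pt; apply/seteqP; split; last exact: near_indices_sub.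
by move=> n /prox_sym /u_pt[m Am /prox_set1 /u_inj ->].
Qed.

Lemma near_indices_prox {X : proximityType} (u : nat -> X) (C D : set X) :
  near_indices u C `&` near_indices u D !=set0 -> prox C D.
Proof. by move=> [n [/prox_sym nC /prox_sym nD]]; exact: prox_point nC nD. Qed.

(** The members of the cluster are the sets near [u @` A] for all [A] in [F];
    this form of the definition turns the cluster axioms into the corresponding
    properties of the ultrafilter. *)
Lemma beta_cluster {X : sepProximityType} (u : nat -> X) (F : betaomega) :
  pointwise_near u -> is_cluster [set C | sval F (near_indices u C)].
Proof.
move=> u_pt; have UF := svalP F; have PF := @ultra_proper _ _ UF.
split=> /=.
- exists setT => /=; apply: filterS filterT => n _.
  by apply: prox_meets; exists (u n).
- move=> A B FA FB; apply: near_indices_prox.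
  exact: filter_ex (filterI FA FB).
- move=> C CF; have [//|FnC] := in_ultra_setVsetC (near_indices u C) UF.
  have /CF : sval F (near_indices u (u @` ~` near_indices u C)).
    by apply: filterS FnC; exact: near_indices_sub.
  by move=> /u_pt[n nCn Cn]; case: (nCn Cn).
- move=> A B FAB.
  have [|FnA] := in_ultra_setVsetC (near_indices u A) UF; first by left.
  right; apply: filterS (filterI FAB FnA) => n [/= /prox_sym].
  by move=> /prox_setU[|] /prox_sym.
Qed.

Definition beta_embed {X : sepProximityType} {u : nat -> X}
    (u_pt : pointwise_near u) (F : betaomega) : smirnov X :=
  exist _ _ (beta_cluster u F u_pt).

(** [C] absorbs the set of clusters that contain it, so a cluster near that set
    has all its members near [C], and contains [C] by maximality. *)
Lemma open_cluster_notin {X : sepProximityType} (C : set X) :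
  open [set s : smirnov X | ~ sval s C].
Proof.
have /(@prox_topology_closedE (smirnov X)) :
    prox_closed [set s : smirnov X | sval s C].
  move=> s /= sC; apply: (cluster_maximal (svalP s)) => A sA.
  by apply/prox_sym/sC => // _ ->.
by rewrite -openC.
Qed.

Section embedding.
Context {X : sepProximityType} {u : nat -> X}.
Context (u_inj : injective u) (u_pt : pointwise_near u).

Lemma beta_embed_image F A : sval (beta_embed u_pt F) (u @` A) <-> sval F A.
Proof. by rewrite /= near_indices_image. Qed.

Lemma beta_embed_inj : injective (beta_embed u_pt).
Proof.
move=> F G FG; apply: betaomega_ext => A /beta_embed_image.
by rewrite FG => /beta_embed_image.
Qed.

(** A cluster in an open set [U] is separated from [~` U] by far sets [C], in
    the cluster, and [D], absorbing [~` U]; every ultrafilter containing the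
    indices near [C] is sent to a cluster that contains [C], hence omits [D],
    hence lies in [U]. *)
Lemma beta_embed_continuous : continuous (beta_embed u_pt).
Proof.
apply/continuousP => U oU.
have cU : prox_closed (~` U).
  by apply/(@prox_topology_closedE (smirnov X)); rewrite closedC.
rewrite openE => F FU; apply/betaomega_nbhsP; apply: contrapT => nF.
suff : smirnov_prox [set beta_embed u_pt F] (~` U) by move=> /cU; exact.
move=> C D CF DU; apply: contrapT => nCD; apply: nF.
exists (near_indices u C); first exact: (CF _ erefl).
move=> G GC; apply: contrapT => /DU GD; apply: nCD.
exact: (cluster_prox (svalP (beta_embed u_pt G)) GC GD).
Qed.

Lemma beta_embed_open_base A :
  beta_embed u_pt @^-1` [set s | ~ sval s (u @` ~` A)] = betaomega_base A.
Proof.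
apply/seteqP; split=> F; rewrite /betaomega_base /preimage /mkset.
  by move=> /beta_embed_image; have [] := in_ultra_setVsetC A (svalP F).
move=> FA /beta_embed_image FnA; have UF := svalP F.
have PF := @ultra_proper _ _ UF.
by have [n []] := filter_ex (filterI FA FnA).
Qed.

Lemma beta_embed_open U : open U ->
  exists2 V, open V & beta_embed u_pt @^-1` V = U.
Proof.
move=> [D _ <-]; exists (\bigcup_(A in D) [set s | ~ sval s (u @` ~` A)]).
  by apply: bigcup_open => A _; exact: open_cluster_notin.
rewrite preimage_bigcup; apply: eq_bigcupr => A _.
exact: beta_embed_open_base.
Qed.

Lemma beta_embed_remainder F : ~ range betaomega_point F ->
  ~ range (@smirnov_point X) (beta_embed u_pt F).
Proof.
move=> nF [p _ pF]; have UF := svalP F; have PF := @ultra_proper _ _ UF.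
have Fp : sval F (near_indices u [set p]).
  have : sval (smirnov_point p) [set p] by exact/prox_set1.
  by rewrite pF.
have [n /prox_set1 pn] := filter_ex Fp.
apply: nF; exists n => //; symmetry; apply: betaomega_set1.
by apply: filterS Fp => m /prox_set1; rewrite pn => /u_inj.
Qed.

(** The traces on [nat] of the balls of radii [1 / (k + 1)] around the image of
    a free ultrafilter [F] would generate [F]: they belong to [F] because the
    embedding is continuous, and each [A] in [F] contains one of them because
    [A] is itself the trace of an open set. *)
Lemma smirnov_not_metrizable (R : realType) : ~ metrizable R (smirnov X).
Proof.
move=> [d md dopen]; have [F ooF] := free_ultrafilter_exists.
pose p := beta_embed u_pt F.
pose B k := [set n |
  (d p (beta_embed u_pt (betaomega_point n)) < k.+1%:R^-1)%R].
apply: (free_ultrafilter_not_countably_generated F B ooF) => [k|A FA].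
  pose V := [set s | (d p s < k.+1%:R^-1)%R].
  have oV : open V.
    apply/dopen => s Vs; exists (k.+1%:R^-1 - d p s)%R.
      by rewrite Num.Theory.subr_gt0.
    move=> t /=; rewrite Num.Theory.ltrBrDl.
    apply: Order.POrderTheory.le_lt_trans; exact: is_metric_triangle.
  have /betaomega_nbhsP[A FA AV] : nbhs F (beta_embed u_pt @^-1` V).
    apply: beta_embed_continuous; apply: open_nbhs_nbhs; split=> //.
    by rewrite /V /= (is_metric_xx md) Num.Theory.invr_gt0 Num.Theory.ltr0Sn.
  have UF := svalP F; apply: filterS FA => n An; apply: AV.
  exact/principal_filterP.
have /dopen/(_ p)[] := open_cluster_notin (u @` ~` A).
  by have /(congr1 (@^~ F)) := beta_embed_open_base A; rewrite /= => ->.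
move=> e e0 eA; have [k] := ltr_add_invr e0; rewrite GRing.add0r => ke.
exists k => n Bn; have /eA :
    (d p (beta_embed u_pt (betaomega_point n)) < e)%R.
  exact: Order.POrderTheory.lt_trans Bn ke.
move=> nA; apply: contrapT => An; apply: nA.
by apply/beta_embed_image/principal_filterP.
Qed.

End embedding.

(** * Subspaces and metrics *)

Lemma embedding_homeomorphic {S T : topologicalType} (f : S -> T) (A : set S) :
  injective f -> continuous f ->
  (forall U, open U -> exists2 V, open V & f @^-1` V = U) ->
  homeomorphic (set_type (f @` A)) (set_type A).
Proof.
move=> f_inj f_cont f_open.
have gP (y : set_type (f @` A)) : exists x : set_type A, f (val x) = val y.
  have [x Ax <-] := set_valP y.
  by exists (SigSub (mem_set Ax)).
have [g gE] := choice gP.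
pose h (x : set_type A) : set_type (f @` A) :=
  SigSub (mem_set (imageP f (set_valP x))).
exists g, h; split.
- apply: continuous_comp_initial; apply/continuousP => _ /f_open[V oV <-].
  exists V => //; apply/funext => y; exact: (congr1 V (esym (gE y))).
- apply: continuous_comp_initial; apply/continuousP => V oV.
  exists (f @^-1` V) => //; exact: open_comp.
- by move=> y; apply: val_inj; rewrite /= gE.
- by move=> x; apply: val_inj; apply: f_inj; rewrite gE.
Qed.

Lemma metric_ge0 {R : realType} {T : Type} {d : T -> T -> R} x y :
  is_metric d -> (0 <= d x y)%R.
Proof.
move=> md; have := is_metric_triangle md y x x.
rewrite (is_metric_xx md) (is_metric_sym md y) -GRing.mulr2n.
by rewrite Num.Theory.pmulrn_lge0.
Qed.

Lemma metric_prox_set1P {R : realType} {T : Type} {d : T -> T -> R} x A :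
  is_metric d ->
  ~ metric_prox d [set x] A <->
    exists2 e, (0 < e)%R & [set y | d x y < e]%R `<=` ~` A.
Proof.
move=> md; set D := [set d a b | a in [set x] & b in A].
have D0 : lbound D 0%R by move=> _ [a _ [b _ <-]]; exact: metric_ge0.
split=> [nxA|[e e0 eA] [_ [a Aa] infD]].
  have [A0|nA0] := pselect (A !=set0); last first.
    by exists 1%R => // y _ Ay; apply: nA0; exists y.
  exists (inf D).
    have [a Aa] := A0.
    rewrite Order.POrderTheory.lt_neqAle lb_le_inf ?andbT //; last first.
      by exists (d x a), x => //; exists a.
    by apply/eqP => D0'; apply: nxA; split=> //; exists x.
  move=> y /= xy Ay; have : (inf D <= d x y)%R.
    by apply: ge_inf; [exists 0%R|exists x => //; exists y].
  by rewrite Order.TotalTheory.leNgt xy.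
have : (e <= inf D)%R.
  apply: lb_le_inf => [|_ [_ -> [b Ab <-]]].
    by exists (d x a), x => //; exists a.
  by rewrite Order.TotalTheory.leNgt; apply/negP => /eA.
by rewrite infD Order.TotalTheory.leNgt e0.
Qed.

Lemma metric_prox_metrizable {R : realType} {X : proximityType}
    (d : X -> X -> R) : is_metric d ->
  (forall A B : set X, prox A B <-> metric_prox d A B) ->
  metrizable R (prox_topology X).
Proof.
move=> md dP; exists d => // U.
have -> : open U <-> prox_closed (~` U).
  by rewrite -prox_topology_closedE closedC.
split=> [cU x Ux|Ud x xU Ux].
  have /(metric_prox_set1P _ _ md) : ~ metric_prox d [set x] (~` U).
    by move=> /dP /cU.
  by rewrite setCK.
by have /dP := xU; apply/(metric_prox_set1P _ _ md); rewrite setCK; exact: Ud.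
Qed.

(** * Selections in a coproduct *)

(** Sets are near in the coproduct through a single summand, and a summand
    contains at most one point of the sequence. *)
Lemma coprod_pointwise_near {I : Type} {X : I -> sepProximityType}
    (e : nat -> I) (x : forall i, X i) : injective e ->
  pointwise_near (fun n => existT X (e n) (x (e n)) : prox_coprod X).
Proof.
move=> e_inj C A [i iCA].
have [_ [z [n An nE]]] := prox_nonempty iCA.
exists n => //; exists i; apply: proxS iCA => y [m _ mE].
suff nm : n = m by rewrite /coprod_slice /= nm.
by apply: e_inj; transitivity i;
  [exact: (congr1 (@projT1 _ _) nE)|exact: (congr1 (@projT1 _ _) (esym mE))].
Qed.

Theorem theorem6p5 (R : realType) (I : Type) (X : I -> sepProximityType)
    (infI : infinite_set [set: I]) (X0 : forall i, [set: X i] !=set0) :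
  [/\ exists2 Y : set (smirnov (prox_coprod X)),
        Y `<=` ~` range (@smirnov_point (prox_coprod X)) &
        homeomorphic (set_type Y) (set_type (~` range betaomega_point)),
      ~ metrizable R (smirnov (prox_coprod X)) &
      ~ exists2 d : smirnov (prox_coprod X) -> smirnov (prox_coprod X) -> R,
          is_metric d &
          forall A B : set (smirnov (prox_coprod X)),
            prox A B <-> metric_prox d A B].
Proof.
have [x _] : exists x : forall i, X i, True.
  by exists (fun i => projT1 (cid (X0 i))).
have /infiniteP/card_leP/injfunPex[e' _ e'_inj] := infI.
pose e n : I := val (e' (to_setT n)).
have e_inj : injective e.
  move=> m n /val_inj /e'_inj mn.
  by apply: (congr1 val (mn _ _)); rewrite inE.
pose u n : prox_coprod X := existT X (e n) (x (e n)).
have u_inj : injective u.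
  by move=> m n /(congr1 (@projT1 _ _)) /e_inj.
have u_pt : pointwise_near u by exact: coprod_pointwise_near.
have nmet := smirnov_not_metrizable u_inj u_pt R.
split=> //; last first.
  by move=> [d md dP]; exact/nmet/(metric_prox_metrizable d md dP).
exists (beta_embed u_pt @` ~` range betaomega_point).
  by move=> _ [F nF <-]; exact: beta_embed_remainder.
apply: embedding_homeomorphic; first exact: beta_embed_inj.
- exact: beta_embed_continuous.
- exact: beta_embed_open.
Qed.
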